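(* Let $(M,\mathcal{T})$ be a closed pseudo $3$-manifold with $v(e)\ge9$ for every $e\in E$. Let $\{l(t):t\in[0,\infty)\}\subset\mathbb{R}^E_{>0}$ be the solution of the extended Ricci flow with initial data $l^0\in(0,\operatorname{arccosh}1.9)^E$ satisfying $l^0_e\in(\operatorname{arccosh}(1+\mu_{v(e)}),\operatorname{arccosh}(b_{v(e)}))$ for all $e\in E$. Assume there exists $t_0>0$ with $\sup\{l_e(t):0\le t\le t_0,\ e\in E\}\le\operatorname{arccosh}2$. Then for each tetrahedron $\sigma$ of $\widehat{\mathcal{T}}$ and each pair $\{e,e'\}$ of opposite edges of $\sigma$, $$\min\{x_e(t),x_{e'}(t)\}\le1.98\quad\text{for all }t\in[0,t_0],$$ where $x_e(t)=\cosh(l_{P_E(e)}(t))$.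
   Context: A closed pseudo $3$-manifold $(M,\mathcal{T})$: a finite disjoint union $\widehat{\mathcal{T}}$ of tetrahedra with faces glued in pairs by affine homeomorphisms; $\mathcal{T}$ the quotient complex, $E$ its edge set, $P_E$ the quotient map from edges of $\widehat{\mathcal{T}}$ to $E$, $v(e)=|P_E^{-1}(e)|$. For an interval $I$, $I^E=\{l: l_e\in I\ \forall e\}$. For $l\in\mathbb{R}^E_{>0}$, in a tetrahedron with vertices $i,j,k,h$ let $x_{ab}=\cosh l_{P_E(ab)}$ and $$\phi_{ij}=\frac{x_{ik}x_{ih}+x_{jk}x_{jh}+x_{ij}x_{ik}x_{jh}+x_{ij}x_{ih}x_{jk}-x_{ij}^2x_{kh}+x_{kh}}{\sqrt{2x_{ij}x_{ik}x_{jk}+x_{ij}^2+x_{ik}^2+x_{jk}^2-1}\sqrt{2x_{ij}x_{ih}x_{jh}+x_{ij}^2+x_{ih}^2+x_{jh}^2-1}},$$ dihedral angle $\alpha_{ij}=\arccos(\max\{-1,\min\{\phi_{ij},1\}\})$; $\widetilde K_e(l)=2\pi-\sum_{\hat e\in P_E^{-1}(e)}\alpha(\hat e)$. Extended Ricci flow: $\frac{d}{dt}l_e=\widetilde K_e(l)l_e$, $l(0)=l^0$ (unique solution for all $t\ge0$). Constants: $b_9=2$, $b_n=\frac{16}{1+\cos(2\pi/n)}-7$ ($n\ge10$); $\eta_\xi(y)=\frac{-2-5y+(1+\xi)^2+\sqrt{(2+5y-(1+\xi)^2)^2+4(2+y)(1-y)(1+\xi)^2}}{2+y}$; $\xi_1=0$,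 $\xi_{k+1}=\eta_{\xi_k}(\cos(2\pi/9))$, $\xi_\infty=\lim_k\xi_k$; $\mu_n=\eta_{\xi_\infty}(\cos(2\pi/n))$. *)

(* Defs.v *)
From Stdlib Require Import Reals Lra.
From Coquelicot Require Import Coquelicot.
From mathcomp Require Import ssreflect ssrfun ssrbool eqtype ssrnat seq choice fintype bigop fingraph.

Set Implicit Arguments.
Unset Strict Implicit.
Unset Printing Implicit Defensive.

Open Scope R_scope.

Definition edge_ends (k : 'I_6) : nat * nat :=
  match nat_of_ord k with
  | 0%N => (0%N, 1%N) | 1%N => (0%N, 2%N) | 2%N => (0%N, 3%N)
  | 3%N => (1%N, 2%N) | 4%N => (1%N, 3%N) | _ => (2%N, 3%N)
  end.

(* the index of the edge joining vertices a <> b *)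
Definition edge_idx (a b : nat) : nat :=
  let p := minn a b in let q := maxn a b in
  if p == 0%N then (q - 1)%N else if p == 1%N then (q + 1)%N else 5%N.

Definition edge_of (a b : 'I_4) : 'I_6 := inord (edge_idx a b).

Definition opp_edge (k : 'I_6) : 'I_6 := inord (5 - k).

Definition v1 (k : 'I_6) : 'I_4 := inord (edge_ends k).1.
Definition v2 (k : 'I_6) : 'I_4 := inord (edge_ends k).2.

(* Closed pseudo 3-manifold: n tetrahedra; faces (s, k) = face of     *)
(* tetrahedron s opposite vertex k.  sg pairs the faces (fixed-point  *)
(* free involution); the affine gluing homeomorphism of face f onto   *)
(* face sg f is given by the vertex bijection ph f : 'I_4 -> 'I_4     *)
(* (sending the opposite vertex f.2 to (sg f).2).                     *)

Definition closed_pseudo3 (n : nat) (sg : 'I_n * 'I_4 -> 'I_n * 'I_4)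
  (ph : 'I_n * 'I_4 -> 'I_4 -> 'I_4) : Prop :=
  [/\ forall f, sg (sg f) = f,
      forall f, sg f <> f,
      forall f, injective (ph f),
      forall f, ph f f.2 = (sg f).2 &
      forall f a, ph (sg f) (ph f a) = a].

Definition tedge (n : nat) : finType := ('I_n * 'I_6)%type.

Definition glue_rel (n : nat) (sg : 'I_n * 'I_4 -> 'I_n * 'I_4)
  (ph : 'I_n * 'I_4 -> 'I_4 -> 'I_4) : rel (tedge n) :=
  fun x y =>
    [exists k : 'I_4,
      [&& k != v1 x.2, k != v2 x.2, (sg (x.1, k)).1 == y.1 &
          y.2 == edge_of (ph (x.1, k) (v1 x.2)) (ph (x.1, k) (v2 x.2))]].

Definition edge_quotient (n : nat) (sg : 'I_n * 'I_4 -> 'I_n * 'I_4)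
  (ph : 'I_n * 'I_4 -> 'I_4 -> 'I_4) (E : finType) (PE : tedge n -> E) : Prop :=
  (forall e : E, exists x, PE x = e) /\
  (forall x y, PE x = PE y <-> connect (glue_rel sg ph) x y).

Definition valence (n : nat) (E : finType) (PE : tedge n -> E) (e : E) : nat :=
  #|[pred x | PE x == e]|.

Definition phi_fun (xij xik xih xjk xjh xkh : R) : R :=
  (xik * xih + xjk * xjh + xij * xik * xjh + xij * xih * xjk
     - xij ^ 2 * xkh + xkh) /
  (sqrt (2 * xij * xik * xjk + xij ^ 2 + xik ^ 2 + xjk ^ 2 - 1) *
   sqrt (2 * xij * xih * xjh + xij ^ 2 + xih ^ 2 + xjh ^ 2 - 1)).

Definition dihedral (n : nat) (E : finType) (PE : tedge n -> E) (l : E -> R)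
  (x : tedge n) : R :=
  let s := x.1 in
  let i := v1 x.2 in let j := v2 x.2 in
  let k := v1 (opp_edge x.2) in let h := v2 (opp_edge x.2) in
  let X a b := cosh (l (PE (s, edge_of a b))) in
  acos (Rmax (-1) (Rmin (phi_fun (X i j) (X i k) (X i h) (X j k) (X j h) (X k h)) 1)).

Definition Kt (n : nat) (E : finType) (PE : tedge n -> E) (l : E -> R) (e : E) : R :=
  2 * PI - \big[Rplus/0]_(x | PE x == e) dihedral PE l x.

Definition ext_ricci_solution (n : nat) (E : finType) (PE : tedge n -> E)
  (l0 : E -> R) (l : R -> E -> R) : Prop :=
  [/\ forall e, l 0 e = l0 e,
      forall t e, 0 <= t -> 0 < l t e,
      forall t e, 0 < t -> is_derive (fun s => l s e) t (Kt PE (l t) e * l t e) &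
      forall e, filterlim (fun h => (l h e - l 0 e) / h) (at_right 0)
                  (locally (Kt PE (l 0) e * l 0 e))].

Definition arccosh (y : R) : R := ln (y + sqrt (y ^ 2 - 1)).

Definition b_const (m : nat) : R :=
  if m == 9%N then 2 else 16 / (1 + cos (2 * PI / INR m)) - 7.

Definition eta (xi y : R) : R :=
  (-2 - 5 * y + (1 + xi) ^ 2 +
   sqrt ((2 + 5 * y - (1 + xi) ^ 2) ^ 2 + 4 * (2 + y) * (1 - y) * (1 + xi) ^ 2))
  / (2 + y).

(* xi_seq k = xi_{k+1} *)
Fixpoint xi_seq (k : nat) : R :=
  match k with
  | 0%N => 0
  | S k' => eta (xi_seq k') (cos (2 * PI / 9))
  end.

Definition xi_inf : R := real (Lim_seq xi_seq).

Definition mu_const (m : nat) : R := eta xi_inf (cos (2 * PI / INR m)).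

(* Main.v *)
Require Import Defs.
From Stdlib Require Import Reals Lra Factorial.
From Coquelicot Require Import Coquelicot.
From mathcomp Require Import ssreflect ssrfun ssrbool eqtype ssrnat seq choice fintype bigop fingraph.

(* Write x = cosh l; on [1, 2]^6 the function phi is nondecreasing in the four edges adjacent to
   the edge considered and nonincreasing in the opposite one, so extremal angles occur at corners.
   It is enough to show that an edge e has negative curvature as soon as x_e and the x_e' of one
   opposite edge e' are at least 1.98: then min(x_e, x_e') cannot increase beyond 1.98.

   One angle at e is at least 0.8301, since x_e' >= 1.98. The other angles could be as small as
   0.6735 if the opposite edge f is short and all four adjacent edges have x = 2, and eight such
   angles are too small. Two barriers along the flow help: an edge of valence at most N keeps
   x >= 1 + d_N, and an edge of valence at least N keeps x <= F_N. If f has small valence, the lower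
   bound on x_f suffices. If f has large valence, it stays short, and this forces the edges
   g adjacent to f down: for each pair g, g' of opposite edges adjacent to f, min(x_g, x_g') stays
   below some B < 1.98, because g is adjacent to f in both tetrahedra at the face spanned by f and
   g, which makes two of the angles at g large. With two of the adjacent edges at most B, the angle
   at e opposite to f is large enough. *)

Set Implicit Arguments.
Unset Strict Implicit.
Unset Printing Implicit Defensive.

Open Scope R_scope.

(** * Monotonicity and bounds of phi *)

(** Going through [Rabs N] avoids any sign condition on [N]; angle bounds thus become polynomial
    inequalities. *)
Lemma sqr_le_sqrt_mul (N k A B : R) :
  0 <= k -> 0 <= A -> 0 <= B -> N ^ 2 <= k ^ 2 * (A * B) ->
  N <= k * (sqrt A * sqrt B).
Proof.
move=> k0 A0 B0 H; rewrite -sqrt_mult //.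
apply: (Rle_trans _ (Rabs N)); first exact: Rle_abs.
rewrite -(sqrt_pow2 k k0) -sqrt_mult; [| nra | nra].
rewrite -sqrt_Rsqr_abs; apply: sqrt_le_1_alt; rewrite /Rsqr; lra.
Qed.

(** Minus the Gram determinant of a face, with diagonal entries 1 and off-diagonal entries [- x],
    [- p], [- q]. *)
Definition face_det (x p q : R) : R := 2 * x * p * q + x ^ 2 + p ^ 2 + q ^ 2 - 1.

(** The edge considered is ij, with cosh [x]; [p], [u] belong to ik, ih, then [q], [v] to jk, jh,
    and [c] to kh. So [p], [v] and [u], [q] are opposite pairs, while [p], [q] and [u], [v] lie in
    the two faces at the edge. *)
Definition phi_num (x p u q v c : R) : R :=
  p * u + q * v + x * p * v + x * u * q - x ^ 2 * c + c.

Lemma phi_funE (x p u q v c : R) :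
  phi_fun x p u q v c =
  phi_num x p u q v c / (sqrt (face_det x p q) * sqrt (face_det x u v)).
Proof. by []. Qed.

Lemma face_det_pos (x p q : R) : 1 <= x -> 1 <= p -> 1 <= q -> 0 < face_det x p q.
Proof. by rewrite /face_det => *; have := Rmult_le_compat 1 x 1 p; nra. Qed.

(** The worst case, adjacent edges 1 and [c = 2], gives 2 (2 - x) (x + 1), which is nonnegative
    exactly up to x = 2. *)
Lemma phi_num_ge0 (x p u q v c : R) :
  1 <= x <= 2 -> 1 <= p -> 1 <= u -> 1 <= q -> 1 <= v -> 1 <= c <= 2 ->
  0 <= phi_num x p u q v c.
Proof.
rewrite /phi_num => hx hp hu hq hv hc.
have h1 : 1 <= p * u by nra.
have h2 : 1 <= q * v by nra.
have h3 : x * 1 <= x * (p * v) by apply: Rmult_le_compat_l; nra.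
have h4 : x * 1 <= x * (u * q) by apply: Rmult_le_compat_l; nra.
have h5 : (x ^ 2 - 1) * c <= (x ^ 2 - 1) * 2 by apply: Rmult_le_compat_l; nra.
nra.
Qed.

(** Together with [phi_fun_swap_faces], this moves any of the four adjacent edges to the position of
    [p]. *)
Lemma phi_fun_swap_ends (x p u q v c : R) : phi_fun x p u q v c = phi_fun x q v p u c.
Proof.
rewrite !phi_funE; congr (_ / (sqrt _ * sqrt _)); rewrite /phi_num /face_det; ring.
Qed.

Lemma phi_fun_swap_faces (x p u q v c : R) : phi_fun x p u q v c = phi_fun x u p v q c.
Proof.
rewrite !phi_funE [sqrt (face_det x u v) * _]Rmult_comm.
congr (_ / _); rewrite /phi_num; ring.
Qed.

Lemma phi_fun_le (x p u q v c k : R) :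
  1 <= x -> 1 <= p -> 1 <= u -> 1 <= q -> 1 <= v ->
  0 <= k -> (phi_num x p u q v c) ^ 2 <= k ^ 2 * (face_det x p q * face_det x u v) ->
  phi_fun x p u q v c <= k.
Proof.
move=> hx hp hu hq hv hk H.
have D1 := face_det_pos hx hp hq; have D2 := face_det_pos hx hu hv.
have s1 := sqrt_lt_R0 _ D1; have s2 := sqrt_lt_R0 _ D2.
rewrite phi_funE; apply/Rle_div_l; first by apply: Rmult_lt_0_compat.
by apply: sqr_le_sqrt_mul => //; lra.
Qed.

(* With phi^2 = (A + B p)^2 / (p^2 + 2 m p + C) as a function of p, the quantity
   G p = B (p^2 + 2 m p + C) - (A + B p)(p + m) carries the sign of the derivative
   of phi, and the difference of the two cross-multiplied squares is
   (p' - p) ((A + B p) G p' + (A + B p') G p). *)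
Lemma phi_fun_incr1 (x p p' u q v c : R) :
  1 <= x <= 2 -> 1 <= p -> p <= p' -> p' <= 2 -> 1 <= u <= 2 -> 1 <= q <= 2 ->
  1 <= v <= 2 -> 1 <= c <= 2 ->
  phi_fun x p u q v c <= phi_fun x p' u q v c.
Proof.
move=> hx hp hpp hp' hu hq hv hc.
have hx1 : 1 <= x by lra.
have hu1 : 1 <= u by lra.
have hq1 : 1 <= q by lra.
have hv1 : 1 <= v by lra.
have hp1 : 1 <= p' by lra.
have D := face_det_pos hx1 hp hq1; have D' := face_det_pos hx1 hp1 hq1.
have D2 := face_det_pos hx1 hu1 hv1.
have s := sqrt_lt_R0 _ D; have s' := sqrt_lt_R0 _ D'; have s2 := sqrt_lt_R0 _ D2.
have N := phi_num_ge0 hx hp hu1 hq1 hv1 hc.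
have N' := phi_num_ge0 hx hp1 hu1 hq1 hv1 hc.
(* This [G] is the one described above with its factor [x ^ 2 - 1] divided out. *)
pose G p := q * (p * v - q * u) + u + x * v + (p + x * q) * c.
(* The only negative term is - q^2 u; with u <= 2 the whole is at least 2 (2 - q) (1 + q). *)
have Gpos : forall r, 1 <= r -> 0 <= G r.
  move=> r hr; rewrite /G.
  have a1 : q * 1 <= q * (r * v) by apply: Rmult_le_compat_l; nra.
  have a2 : 0 <= (q ^ 2 - 1) * (2 - u) by apply: Rmult_le_pos; nra.
  have a3 : 1 <= x * v by nra.
  have a4 : (1 + q) * 1 <= (r + x * q) * c by apply: Rmult_le_compat; nra.
  nra.
have key : (phi_num x p u q v c) ^ 2 * face_det x p' q
           <= (phi_num x p' u q v c) ^ 2 * face_det x p q.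
  have -> : (phi_num x p' u q v c) ^ 2 * face_det x p q =
     (phi_num x p u q v c) ^ 2 * face_det x p' q +
     (p' - p) * (x ^ 2 - 1) *
       (phi_num x p u q v c * G p' + phi_num x p' u q v c * G p).
    by rewrite /phi_num /face_det /G; ring.
  have g := Gpos p hp; have g' := Gpos p' hp1.
  have := Rmult_le_pos _ _ N g'; have := Rmult_le_pos _ _ N' g => e1 e2.
  have x2 : 0 <= x ^ 2 - 1 by nra.
  have := Rmult_le_pos _ _ (Rmult_le_pos (p' - p) _ ltac:(lra) x2) (Rplus_le_le_0_compat _ _ e2 e1).
  lra.
have key2 : phi_num x p u q v c * sqrt (face_det x p' q)
            <= phi_num x p' u q v c * sqrt (face_det x p q).
  rewrite -(sqrt_pow2 _ N) -(sqrt_pow2 _ N') -!sqrt_mult; try nra.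
  by apply: sqrt_le_1_alt.
rewrite !phi_funE.
apply/Rle_div_l; first by apply: Rmult_lt_0_compat.
have -> : forall n d' d d2, 0 < d' -> 0 < d2 -> n / (d' * d2) * (d * d2) = n * d / d'.
  by move=> *; field; lra.
  2, 3: done.
by apply/Rle_div_r.
Qed.

Lemma phi_fun_incr (x p p' u u' q q' v v' c : R) :
  1 <= x <= 2 -> 1 <= c <= 2 -> 1 <= p <= p' -> p' <= 2 -> 1 <= u <= u' -> u' <= 2 ->
  1 <= q <= q' -> q' <= 2 -> 1 <= v <= v' -> v' <= 2 ->
  phi_fun x p u q v c <= phi_fun x p' u' q' v' c.
Proof.
move=> hx hc [? ?] ? [? ?] ? [? ?] ? [? ?] ?.
apply: (Rle_trans _ (phi_fun x p' u q v c)); first by apply: phi_fun_incr1; lra.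
rewrite phi_fun_swap_ends [X in _ <= X]phi_fun_swap_ends.
apply: (Rle_trans _ (phi_fun x q' v p' u c)); first by apply: phi_fun_incr1; lra.
rewrite phi_fun_swap_faces [X in _ <= X]phi_fun_swap_faces.
apply: (Rle_trans _ (phi_fun x v' q' u p' c)); first by apply: phi_fun_incr1; lra.
rewrite phi_fun_swap_ends [X in _ <= X]phi_fun_swap_ends.
by apply: phi_fun_incr1; lra.
Qed.

Lemma phi_fun_decr_opp (x p u q v c c' : R) :
  1 <= x -> 1 <= p -> 1 <= u -> 1 <= q -> 1 <= v -> c <= c' ->
  phi_fun x p u q v c' <= phi_fun x p u q v c.
Proof.
move=> hx hp hu hq hv hc.
have s1 := sqrt_lt_R0 _ (face_det_pos hx hp hq).
have s2 := sqrt_lt_R0 _ (face_det_pos hx hu hv).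
rewrite !phi_funE; apply: Rmult_le_compat_r.
  by apply/Rlt_le/Rinv_0_lt_compat/Rmult_lt_0_compat.
have e : 0 <= (x ^ 2 - 1) * (c' - c) by apply: Rmult_le_pos; nra.
rewrite /phi_num; lra.
Qed.

(** With all adjacent edges at 2 a factor x + 1 cancels and phi becomes (8 - (x - 1) c) / (x + 7),
    which decreases in [x] and in [c]; hence the test at [b] and [c0]. *)
Lemma phi_fun_le_all2 (b x p u q v c c0 k : R) :
  1 <= b <= x -> x <= 2 -> 1 <= p <= 2 -> 1 <= u <= 2 -> 1 <= q <= 2 -> 1 <= v <= 2 ->
  1 <= c0 <= c -> c <= 2 -> 0 <= k -> 8 - (b - 1) * c0 <= k * (b + 7) ->
  phi_fun x p u q v c <= k.
Proof.
move=> hb hx hp hu hq hv hc hc2 hk H.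
apply: (Rle_trans _ (phi_fun x 2 2 2 2 c)); first by apply: phi_fun_incr; lra.
apply: (Rle_trans _ (phi_fun x 2 2 2 2 c0)); first by apply: phi_fun_decr_opp; lra.
apply: phi_fun_le; try lra.
have E : 8 - (x - 1) * c0 <= k * (x + 7).
  have e1 : 0 <= (x - b) * c0 by apply: Rmult_le_pos; lra.
  have e2 : 0 <= (x - b) * k by apply: Rmult_le_pos; lra.
  lra.
have F : 0 <= 8 - (x - 1) * c0 by nra.
rewrite (_ : phi_num _ _ _ _ _ _ = (x + 1) * (8 - (x - 1) * c0)); last by rewrite /phi_num; ring.
rewrite (_ : k ^ 2 * _ = ((x + 1) * (k * (x + 7))) ^ 2); last by rewrite /face_det; ring.
apply: pow_incr; split; first by apply: Rmult_le_pos; lra.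
by apply: Rmult_le_compat_l; lra.
Qed.

(** At the corner with adjacent edges 1 and opposite edge 2, phi equals 2 (2 - x) / (x + 1), which
    decreases in [x]. *)
Lemma phi_fun_ge (z x p u q v c : R) :
  1 <= x <= 1 + z -> z <= 1 -> 1 <= p <= 2 -> 1 <= u <= 2 -> 1 <= q <= 2 -> 1 <= v <= 2 ->
  1 <= c <= 2 -> 2 * (1 - z) / (2 + z) <= phi_fun x p u q v c.
Proof.
move=> hx hz hp hu hq hv hc.
apply: (Rle_trans _ (phi_fun x 1 1 1 1 c)); last by apply: phi_fun_incr; lra.
apply: (Rle_trans _ (phi_fun x 1 1 1 1 2)); last by apply: phi_fun_decr_opp; lra.
rewrite phi_funE (_ : face_det x 1 1 = (x + 1) ^ 2); last by rewrite /face_det; ring.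
rewrite sqrt_pow2; last lra.
rewrite (_ : phi_num _ _ _ _ _ _ = (x + 1) * (2 * (2 - x))); last by rewrite /phi_num; ring.
rewrite (_ : _ / ((x + 1) * (x + 1)) = 2 * (2 - x) / (x + 1)); last by field; lra.
rewrite (_ : 2 * (1 - z) / (2 + z) = 2 * (1 - z) * (x + 1) * / ((2 + z) * (x + 1))); last by field; lra.
rewrite (_ : 2 * (2 - x) / (x + 1) = 2 * (2 - x) * (2 + z) * / ((2 + z) * (x + 1))); last by field; lra.
apply: Rmult_le_compat_r; last nra.
by apply/Rlt_le/Rinv_0_lt_compat/Rmult_lt_0_compat; lra.
Qed.

Lemma phi_fun_le_adj (F c0 x p u q v c k : R) :
  1 <= x <= 2 -> 1 <= p <= 2 -> 1 <= u <= 2 -> 1 <= q <= 2 -> 1 <= v <= 2 ->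
  1 <= c0 <= c -> c <= 2 -> F <= 2 -> [\/ p <= F, u <= F, q <= F | v <= F] -> 0 <= k ->
  (phi_num x F 2 2 2 c0) ^ 2 <= k ^ 2 * (face_det x F 2 * face_det x 2 2) ->
  phi_fun x p u q v c <= k.
Proof.
move=> hx hp hu hq hv hc hc2 hF hor hk H.
wlog: p u q v hp hu hq hv hor / p <= F.
  move=> W; case: hor => h.
  - by apply: W => //; apply: Or41.
  - by rewrite phi_fun_swap_faces; apply: W => //; apply: Or41.
  - by rewrite phi_fun_swap_ends; apply: W => //; apply: Or41.
  - by rewrite phi_fun_swap_faces phi_fun_swap_ends; apply: W => //; apply: Or41.
move=> h.
apply: (Rle_trans _ (phi_fun x F 2 2 2 c)); first by apply: phi_fun_incr; lra.
apply: (Rle_trans _ (phi_fun x F 2 2 2 c0)); first by apply: phi_fun_decr_opp; lra.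
by apply: phi_fun_le => //; lra.
Qed.

(** One short edge from each opposite pair gives, up to symmetry, either [p], [u], meeting at an end
    of the edge considered, or [p], [q], lying in one face with it. The two polynomial conditions
    treat these two configurations. *)
Lemma phi_fun_le_pairs (B c0 x p u q v c k : R) :
  1 <= x <= 2 -> 1 <= p <= 2 -> 1 <= u <= 2 -> 1 <= q <= 2 -> 1 <= v <= 2 ->
  1 <= c0 <= c -> c <= 2 -> B <= 2 -> Rmin p v <= B -> Rmin u q <= B -> 0 <= k ->
  (phi_num x B B 2 2 c0) ^ 2 <= k ^ 2 * (face_det x B 2 * face_det x B 2) ->
  (phi_num x B 2 B 2 c0) ^ 2 <= k ^ 2 * (face_det x B B * face_det x 2 2) ->
  phi_fun x p u q v c <= k.
Proof.
move=> hx hp hu hq hv hc hc2 hB m1 m2 hk H1 H2.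
wlog: p u q v hp hu hq hv m1 m2 / p <= B.
  move=> W; have := m1; rewrite {1}/Rmin; case: Rle_dec => _ h; first exact: W.
  by rewrite phi_fun_swap_faces phi_fun_swap_ends; apply: W; rewrite // Rmin_comm.
move=> h.
have [h' | h'] : u <= B \/ q <= B.
  by move: m2; rewrite /Rmin; case: Rle_dec => _; [left | right].
- apply: (Rle_trans _ (phi_fun x B B 2 2 c)); first by apply: phi_fun_incr; lra.
  apply: (Rle_trans _ (phi_fun x B B 2 2 c0)); first by apply: phi_fun_decr_opp; lra.
  by apply: phi_fun_le => //; lra.
- apply: (Rle_trans _ (phi_fun x B 2 B 2 c)); first by apply: phi_fun_incr; lra.
  apply: (Rle_trans _ (phi_fun x B 2 B 2 c0)); first by apply: phi_fun_decr_opp; lra.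
  by apply: phi_fun_le => //; lra.
Qed.

(** * Numerical trigonometry *)

Definition cos_taylor6 (th : R) : R := 1 - th ^ 2 / 2 + th ^ 4 / 24 - th ^ 6 / 720.

Lemma cos_taylor6_le (a : R) : -2 <= a <= 2 -> cos_taylor6 a <= cos a.
Proof.
move=> ha; rewrite /cos_taylor6; have [H _] := pre_cos_bound a 1 (proj1 ha) (proj2 ha).
move: H; rewrite /cos_approx /cos_term /= => H; lra.
Qed.

Lemma cos_le_taylor4 (a : R) :
  -2 <= a <= 2 -> cos a <= 1 - a ^ 2 / 2 + a ^ 4 / 24.
Proof.
move=> ha; have [_ H] := pre_cos_bound a 0 (proj1 ha) (proj2 ha).
move: H; rewrite /cos_approx /cos_term /= => H; lra.
Qed.

Lemma cos_le_taylor8 (a : R) :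
  -2 <= a <= 2 -> cos a <= 1 - a ^ 2 / 2 + a ^ 4 / 24 - a ^ 6 / 720 + a ^ 8 / 40320.
Proof.
move=> ha; have [_ H] := pre_cos_bound a 1 (proj1 ha) (proj2 ha).
have f8 : INR (Factorial.fact 8) = 40320.
  by rewrite INR_IZR_INZ; apply: (f_equal IZR); vm_compute.
move: H; rewrite (_ : Nat.mul 2 (Nat.add 1 1) = 4%nat) // /cos_approx /sum_f_R0 /cos_term.
rewrite (_ : Nat.mul 2 4 = 8%nat) // f8 /= => H; lra.
Qed.

(* Compares cos (PI / 6) = sqrt 3 / 2 with Taylor polynomials. *)
Lemma PI_bounds : 3.1415 < PI < 3.1416.
Proof.
have s3 : sqrt 3 * sqrt 3 = 3 by apply: sqrt_sqrt; lra.
have s0 := sqrt_pos 3; have P := PI2_3_2; have P4 := PI_4.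
have C := cos_PI6.
split; apply: Rnot_le_lt => h.
- have : cos (3.1415 / 6) <= cos (PI / 6) by apply: cos_decr_1; lra.
  have := @cos_taylor6_le (3.1415 / 6) ltac:(lra); rewrite /cos_taylor6; nra.
- have : cos (PI / 6) <= cos (3.1416 / 6) by apply: cos_decr_1; lra.
  have := @cos_le_taylor8 (3.1416 / 6) ltac:(lra); nra.
Qed.

Lemma le_acos_clamp (a y : R) :
  0 <= a <= PI -> y <= cos a -> a <= acos (Rmax (-1) (Rmin y 1)).
Proof.
move=> ha h; have [c1 c2] := COS_bound a.
have h1 : Rmax (-1) (Rmin y 1) <= cos a.
  by apply: Rmax_lub => //; apply: (Rle_trans _ y) => //; apply: Rmin_l.
have h2 : -1 <= Rmax (-1) (Rmin y 1) by apply: Rmax_l.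
apply: Rnot_lt_le => h3.
have [b1 b2] := acos_bound (Rmax (-1) (Rmin y 1)).
have := cos_decreasing_1 _ _ b1 b2 (proj1 ha) (proj2 ha) h3.
rewrite cos_acos; lra.
Qed.

Lemma acos_clamp_le (a y : R) :
  0 <= a <= PI -> cos a <= y -> acos (Rmax (-1) (Rmin y 1)) <= a.
Proof.
move=> ha h; have [c1 c2] := COS_bound a.
have h1 : cos a <= Rmax (-1) (Rmin y 1).
  by apply: Rle_trans (Rmax_r _ _); apply: Rmin_glb.
have h2 : Rmax (-1) (Rmin y 1) <= 1 by apply: Rmax_lub; [lra | apply: Rmin_r].
apply: Rnot_lt_le => h3.
have [b1 b2] := acos_bound (Rmax (-1) (Rmin y 1)).
have := cos_decreasing_1 _ _ (proj1 ha) (proj2 ha) b1 b2 h3.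
rewrite cos_acos; lra.
Qed.

(** * Monotonicity of [cosh] and its inverse *)

Lemma cosh_lt_compat (a b : R) : 0 <= a -> a < b -> cosh a < cosh b.
Proof.
move=> ha hab; rewrite /cosh !exp_Ropp.
have h1 : exp a < exp b by apply: exp_increasing.
have h2 : 1 <= exp a by rewrite -exp_0; case: ha => [h | <-]; [left; apply: exp_increasing | right].
(* Divided by exp a exp b, this product is 2 (cosh b - cosh a). *)
have h3 : 0 < (exp b - exp a) * (exp a * exp b - 1) by apply: Rmult_lt_0_compat; nra.
have Ea : / exp a = / exp a * / exp b * exp b by field; lra.
have Eb : / exp b = / exp a * / exp b * exp a by field; lra.
have I : 0 < / exp a * / exp b by apply: Rmult_lt_0_compat; apply: Rinv_0_lt_compat; lra.
have := Rmult_lt_0_compat _ _ I h3.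
have -> : / exp a * / exp b * ((exp b - exp a) * (exp a * exp b - 1)) =
          exp b - exp a - / exp a * / exp b * (exp b - exp a) by field; lra.
rewrite Rmult_minus_distr_l; lra.
Qed.

Lemma cosh_le_compat (a b : R) : 0 <= a -> a <= b -> cosh a <= cosh b.
Proof. by move=> ha [h | ->]; [left; apply: cosh_lt_compat | right]. Qed.

Lemma one_lt_cosh (a : R) : 0 < a -> 1 < cosh a.
Proof. by move=> h; rewrite -cosh_0; apply: cosh_lt_compat; lra. Qed.

Lemma arccosh_arg (y : R) : 1 <= y -> 1 <= y + sqrt (y ^ 2 - 1).
Proof. by move=> h; have := sqrt_pos (y ^ 2 - 1); lra. Qed.

Lemma cosh_arccosh (y : R) : 1 <= y -> cosh (arccosh y) = y.
Proof.
move=> h; have h1 := arccosh_arg h.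
rewrite /cosh /arccosh exp_Ropp exp_ln; last lra.
have s : sqrt (y ^ 2 - 1) * sqrt (y ^ 2 - 1) = y ^ 2 - 1 by apply: sqrt_sqrt; nra.
have -> : / (y + sqrt (y ^ 2 - 1)) = y - sqrt (y ^ 2 - 1).
  by apply: (Rmult_eq_reg_l (y + sqrt (y ^ 2 - 1))); [rewrite Rinv_r; nra | lra].
lra.
Qed.

Lemma arccosh_ge0 (y : R) : 1 <= y -> 0 <= arccosh y.
Proof.
move=> h; rewrite /arccosh -ln_1.
case: (arccosh_arg h) => [h1 | <-]; [left; apply: ln_increasing; lra | by right].
Qed.

Lemma cosh_lt_arccosh (a y : R) : 0 < a -> 1 <= y -> a < arccosh y <-> cosh a < y.
Proof.
move=> ha hy; rewrite -{2}(cosh_arccosh hy); split => h; first by apply: cosh_lt_compat; lra.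
by apply: Rnot_le_lt => h'; have := cosh_le_compat (arccosh_ge0 hy) h'; lra.
Qed.

Lemma cosh_le_arccosh (a y : R) : 0 < a -> 1 <= y -> a <= arccosh y <-> cosh a <= y.
Proof.
move=> ha hy; rewrite -{2}(cosh_arccosh hy); split => h; first by apply: cosh_le_compat; lra.
by apply: Rnot_lt_le => h'; have := cosh_lt_compat (arccosh_ge0 hy) h'; lra.
Qed.

(** * Barriers for differentiable functions *)

(** At time 0 the flow has only a one-sided derivative; bounding the difference quotient by |k| + 1
    still preserves strict initial inequalities for a short time. *)
Lemma right_derivative_continuous (f : R -> R) (k eps : R) :
  filterlim (fun h => (f h - f 0) / h) (at_right 0) (locally k) -> 0 < eps ->
  exists d, 0 < d /\ forall t, 0 < t < d -> Rabs (f t - f 0) < eps.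
Proof.
move=> H he.
have [d Hd] := H _ (locally_ball k (mkposreal 1 Rlt_0_1)).
have M0 : 0 < Rabs k + 1 by have := Rabs_pos k; lra.
exists (Rmin d (eps / (Rabs k + 1))); split.
  by apply: Rmin_glb_lt; [exact: cond_pos | apply: Rdiv_lt_0_compat; lra].
move=> t [t0 td].
have h1 : t < d by apply: Rlt_le_trans td (Rmin_l _ _).
have h2 : t < eps / (Rabs k + 1) by apply: Rlt_le_trans td (Rmin_r _ _).
have h3 : Rabs ((f t - f 0) / t - k) < 1.
  apply: (Hd t) => //; rewrite /ball /= /AbsRing_ball /abs /minus /plus /opp /=.
  by rewrite Ropp_0 Rplus_0_r Rabs_pos_eq; lra.
have h4 : Rabs ((f t - f 0) / t) < Rabs k + 1.
  have := Rabs_triang ((f t - f 0) / t - k) k.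
  by rewrite (_ : (f t - f 0) / t - k + k = (f t - f 0) / t); [lra | ring].
have h5 : Rabs (f t - f 0) = Rabs ((f t - f 0) / t) * t.
  have e : f t - f 0 = (f t - f 0) / t * t by field; lra.
  by rewrite {1}e Rabs_mult (Rabs_pos_eq t); lra.
have h6 := (proj2 (Rlt_div_r _ _ _ M0)) h2.
rewrite h5; nra.
Qed.

(* At the last time at which min f g <= L both functions would have to be
   larger than at any later time. *)
Lemma min_barrier (f g f' g' : R -> R) (L d T : R) :
  (forall t, 0 < t -> is_derive f t (f' t)) ->
  (forall t, 0 < t -> is_derive g t (g' t)) ->
  0 < d -> (forall t, 0 < t < d -> Rmin (f t) (g t) <= L) ->
  (forall t, 0 < t <= T -> L < f t -> L < g t -> f' t < 0 /\ g' t < 0) ->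
  forall t, 0 < t <= T -> Rmin (f t) (g t) <= L.
Proof.
move=> df dg hd h0 hneg t ht; apply: Rnot_lt_le => hm.
have min_gt : forall s, L < Rmin (f s) (g s) <-> L < f s /\ L < g s.
  move=> s; rewrite /Rmin; case: Rle_dec; lra.
pose S s := 0 < s <= t /\ Rmin (f s) (g s) <= L.
have bS : bound S by exists t => s [[]].
have S0 : S (Rmin d t / 2).
  have a : 0 < Rmin d t by apply: Rmin_glb_lt; lra.
  have b := Rmin_l d t; have c := Rmin_r d t.
  by split; [lra | apply: h0; lra].
have [u [ub lub]] := completeness S bS (ex_intro _ _ S0).
have u0 : 0 < u.
  by apply: Rlt_le_trans (ub _ S0); case: S0 => [[]].
have ut : u <= t by apply: lub => s [[]].
have mu : Rmin (f u) (g u) <= L.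
  apply: Rnot_lt_le => /min_gt [fu gu].
  have cont : forall h h', is_derive h u h' -> L < h u -> locally u (fun s => L < h s).
    move=> h h' dh hu.
    have c : continuous h u by apply: ex_derive_continuous; exists h'.
    exact: (c (fun y => L < y) (open_gt L _ hu)).
  have [e He] := filter_and _ _ (cont _ _ (df u u0) fu) (cont _ _ (dg u u0) gu).
  have e0 := cond_pos e.
  (* No time of [S] lies within [e] of [u], so a smaller upper bound would exist. *)
  have : u <= u - e / 2; last lra.
  apply: lub => s Ss; have su := ub _ Ss; apply: Rnot_lt_le => hs.
  have [] : L < f s /\ L < g s.
    apply: He; rewrite /ball /= /AbsRing_ball /abs /minus /plus /opp /=.
    by apply: Rabs_def1; lra.
  by move=> a b; have /min_gt := conj a b; case: Ss => _; lra.
have ut' : u < t by case: ut => // eut; move: mu; rewrite eut; lra.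
have later : forall s, u < s <= t -> L < f s /\ L < g s.
  move=> s hs; apply/min_gt; apply: Rnot_le_lt => hL.
  have : s <= u by apply: ub; split=> //; lra.
  lra.
have dec : forall h h', (forall s, 0 < s -> is_derive h s (h' s)) ->
    (forall s, u < s <= t -> h' s < 0) -> h t < h u.
  move=> h h' dh hn.
  have [c [Ec hc]] : exists c, h t - h u = h' c * (t - u) /\ u < c < t.
    by apply: MVT_cor2 => // c hc; apply/is_derive_Reals/dh; lra.
  have := hn c ltac:(lra); nra.
have [ft gt'] := later t ltac:(lra).
have := dec _ _ df (fun s hs => proj1 (hneg s ltac:(lra) (proj1 (later s hs)) (proj2 (later s hs)))).
have := dec _ _ dg (fun s hs => proj2 (hneg s ltac:(lra) (proj1 (later s hs)) (proj2 (later s hs)))).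
move=> a b; have /min_gt : L < f u /\ L < g u by lra.
lra.
Qed.

(** * Angle sums and combinatorics of the gluing *)

(** Counting occurrences lets the induction run over any sequence; on a duplicate-free enumeration
    of an edge class both counts are 1. Distinctness of [x0] and [y0] keeps one term from being
    credited with both gains. *)
Lemma sum_ge_two_special (T : eqType) (s : seq T) (F : T -> R) (x0 y0 : T) (th th1 th2 : R) :
  x0 != y0 -> (forall x, x \in s -> th <= F x) -> th1 <= F x0 -> th2 <= F y0 ->
  th * INR (size s) + (th1 - th) * INR (count_mem x0 s) + (th2 - th) * INR (count_mem y0 s)
  <= \big[Rplus/0]_(x <- s) F x.
Proof.
move=> xy; elim: s => [|a s IH] h h1 h2; first by rewrite big_nil /=; lra.
rewrite big_cons.
have := IH (fun x hx => h x (mem_behead (s := a :: s) hx)) h1 h2.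
have ha := h a (mem_head _ _).
have ct z : INR (count_mem z (a :: s)) = INR (a == z) + INR (count_mem z s).
  by rewrite -plus_INR.
have sz : INR (size (a :: s)) = INR (size s) + 1 := S_INR _.
rewrite !ct sz.
case: (a =P x0) => [ax | _].
  by rewrite -ax in xy h1; rewrite (negbTE xy) /=; lra.
by case: (a =P y0) => [ay | _] /=; [rewrite -ay in h2 |]; lra.
Qed.

Lemma sum_ge_const (T : eqType) (s : seq T) (F : T -> R) (th : R) :
  (forall x, x \in s -> th <= F x) -> th * INR (size s) <= \big[Rplus/0]_(x <- s) F x.
Proof.
elim: s => [|a s IH] h; first by rewrite big_nil /=; lra.
rewrite big_cons; have := IH (fun x hx => h x (mem_behead (s := a :: s) hx)).
have := h a (mem_head _ _).
by rewrite (S_INR (size s) : INR (size (a :: s)) = _); lra.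
Qed.

Lemma sum_le_const (T : eqType) (s : seq T) (F : T -> R) (th : R) :
  (forall x, x \in s -> F x <= th) -> \big[Rplus/0]_(x <- s) F x <= th * INR (size s).
Proof.
elim: s => [|a s IH] h; first by rewrite big_nil /=; lra.
rewrite big_cons; have := IH (fun x hx => h x (mem_behead (s := a :: s) hx)).
have := h a (mem_head _ _).
by rewrite (S_INR (size s) : INR (size (a :: s)) = _); lra.
Qed.

Lemma KtE (n : nat) (E : finType) (PE : tedge n -> E) (l : E -> R) (e : E) :
  Kt PE l e = 2 * PI - \big[Rplus/0]_(x <- enum [pred x | PE x == e]) dihedral PE l x.
Proof. by rewrite /Kt big_filter [index_enum _]unlock. Qed.

(** Valence at least 9 leaves at least seven ordinary angles, and any further ones only help since
    [0 <= th]. *)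
Lemma Kt_neg_two_special (n : nat) (E : finType) (PE : tedge n -> E) (l : E -> R) (e : E)
    (x0 y0 : tedge n) (th th1 th2 : R) :
  (9 <= valence PE e)%N -> PE x0 = e -> PE y0 = e -> x0 != y0 -> 0 <= th ->
  (forall x, PE x = e -> th <= dihedral PE l x) ->
  th1 <= dihedral PE l x0 -> th2 <= dihedral PE l y0 ->
  2 * PI < th1 + th2 + 7 * th -> Kt PE l e < 0.
Proof.
move=> hv hx hy xy th0 h h1 h2 hs.
set s := enum [pred x | PE x == e].
have sz : 9 <= INR (size s).
  by rewrite -(INR_IZR_INZ 9); apply: le_INR; apply/leP; rewrite -cardE.
have mem x : (x \in s) = (PE x == e) by rewrite mem_enum.
have hs' x : x \in s -> th <= dihedral PE l x by rewrite mem => /eqP; apply: h.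
have := sum_ge_two_special xy hs' h1 h2.
have us : uniq s by apply: enum_uniq.
have := Rmult_le_compat_l _ _ _ th0 sz.
by rewrite !count_uniq_mem // !mem hx hy eqxx KtE -/s /=; lra.
Qed.

Lemma Kt_neg_one_special (n : nat) (E : finType) (PE : tedge n -> E) (l : E -> R) (e : E)
    (x0 : tedge n) (th th1 : R) :
  (9 <= valence PE e)%N -> PE x0 = e -> 0 <= th ->
  (forall x, PE x = e -> th <= dihedral PE l x) ->
  th1 <= dihedral PE l x0 -> 2 * PI < th1 + 8 * th -> Kt PE l e < 0.
Proof.
move=> hv hx th0 h h1 hs.
have [y hy xy] : exists2 y, PE y = e & x0 != y.
  have /card_gt1P [a [b [/eqP ha /eqP hb ab]]] : (1 < valence PE e)%N by apply: leq_trans hv.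
  by case: (x0 =P a) => [-> | /eqP xa]; [exists b | exists a].
by apply: (Kt_neg_two_special hv hx hy xy th0 h h1 (h y hy)); lra.
Qed.

Lemma Kt_neg_valence_ge (n : nat) (E : finType) (PE : tedge n -> E) (l : E -> R) (e : E)
    (N : nat) (th : R) :
  (N <= valence PE e)%N -> 0 <= th -> (forall x, PE x = e -> th <= dihedral PE l x) ->
  2 * PI < th * INR N -> Kt PE l e < 0.
Proof.
move=> hv th0 h hs; rewrite KtE.
set s := enum _.
have sz : INR N <= INR (size s) by apply: le_INR; apply/leP; rewrite -cardE.
have hs' x : x \in s -> th <= dihedral PE l x by rewrite mem_enum => /eqP; apply: h.
apply: Rlt_minus; apply: Rlt_le_trans hs _.
exact: Rle_trans (Rmult_le_compat_l _ _ _ th0 sz) (sum_ge_const hs').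
Qed.

Lemma Kt_pos_valence_le (n : nat) (E : finType) (PE : tedge n -> E) (l : E -> R) (e : E)
    (N : nat) (th : R) :
  (valence PE e <= N)%N -> 0 <= th -> (forall x, PE x = e -> dihedral PE l x <= th) ->
  th * INR N < 2 * PI -> 0 < Kt PE l e.
Proof.
move=> hv th0 h hs; rewrite KtE.
set s := enum _.
have sz : INR (size s) <= INR N by apply: le_INR; apply/leP; rewrite -cardE.
have hs' x : x \in s -> dihedral PE l x <= th by rewrite mem_enum => /eqP; apply: h.
apply: Rlt_Rminus; apply: Rle_lt_trans hs.
exact: Rle_trans (sum_le_const hs') (Rmult_le_compat_l _ _ _ th0 sz).
Qed.

(** * Edges of a tetrahedron and face gluings *)

Lemma edge_idx_lt6 (a b : 'I_4) : (edge_idx a b < 6)%N.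
Proof. by case: a b => [[|[|[|[|//]]]] ?] [[|[|[|[|//]]]] ?]. Qed.

Lemma edge_ofC (a b : 'I_4) : edge_of a b = edge_of b a.
Proof. by rewrite /edge_of /edge_idx minnC maxnC. Qed.

Lemma val_v1 (k : 'I_6) : v1 k = (edge_ends k).1 :> nat.
Proof. by rewrite /v1; case: k => [[|[|[|[|[|[|//]]]]]] ?]; rewrite inordK. Qed.

Lemma val_v2 (k : 'I_6) : v2 k = (edge_ends k).2 :> nat.
Proof. by rewrite /v2; case: k => [[|[|[|[|[|[|//]]]]]] ?]; rewrite inordK. Qed.

Lemma edge_of_ends (k : 'I_6) : edge_of (v1 k) (v2 k) = k.
Proof.
apply: val_inj; rewrite /edge_of /= inordK ?edge_idx_lt6 // val_v1 val_v2.
by case: k => [[|[|[|[|[|[|//]]]]]] ?].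
Qed.

Lemma opp_edge_val (k : 'I_6) : opp_edge k = (5 - k)%N :> nat.
Proof. by rewrite /opp_edge inordK // ltnS leq_subr. Qed.

Lemma tet_vertices_uniq (k : 'I_6) :
  uniq [:: v1 k; v2 k; v1 (opp_edge k); v2 (opp_edge k)].
Proof.
rewrite -(map_inj_uniq val_inj) /= !val_v1 !val_v2 /edge_ends opp_edge_val.
by case: k => [[|[|[|[|[|[|//]]]]]] ?].
Qed.

Lemma ends_edge_of (a b : 'I_4) : a != b ->
  v1 (edge_of a b) = a /\ v2 (edge_of a b) = b \/
  v1 (edge_of a b) = b /\ v2 (edge_of a b) = a.
Proof.
move=> ab.
have H : (v1 (edge_of a b) == a) && (v2 (edge_of a b) == b) ||
         (v1 (edge_of a b) == b) && (v2 (edge_of a b) == a).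
  move: ab; rewrite -!(inj_eq val_inj) /= !val_v1 !val_v2 /edge_ends /edge_of.
  rewrite inordK ?edge_idx_lt6 //.
  by case: a b => [[|[|[|[|//]]]] ?] [[|[|[|[|//]]]] ?].
by case/orP: H => /andP [/eqP -> /eqP ->]; [left | right].
Qed.

Lemma opp_edgeK (k : 'I_6) : opp_edge (opp_edge k) = k.
Proof. by apply: val_inj; rewrite /= !opp_edge_val; case: k => [[|[|[|[|[|[|//]]]]]] ?]. Qed.

(* The four edges adjacent to [k], in the order in which [dihedral] feeds them to [phi_fun]. *)
Definition adj_ik (k : 'I_6) : 'I_6 := edge_of (v1 k) (v1 (opp_edge k)).
Definition adj_ih (k : 'I_6) := edge_of (v1 k) (v2 (opp_edge k)).
Definition adj_jk (k : 'I_6) := edge_of (v2 k) (v1 (opp_edge k)).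
Definition adj_jh (k : 'I_6) := edge_of (v2 k) (v2 (opp_edge k)).

Lemma val_edge_of (a b : 'I_4) : edge_of a b = edge_idx a b :> nat.
Proof. by rewrite /edge_of inordK ?edge_idx_lt6. Qed.

Lemma opp_adj_ik (k : 'I_6) : opp_edge (adj_ik k) = adj_jh k.
Proof.
apply: val_inj; rewrite /= opp_edge_val !val_edge_of !val_v1 !val_v2 /edge_ends opp_edge_val.
by case: k => [[|[|[|[|[|[|//]]]]]] ?].
Qed.

Lemma opp_adj_ih (k : 'I_6) : opp_edge (adj_ih k) = adj_jk k.
Proof.
apply: val_inj; rewrite /= opp_edge_val !val_edge_of !val_v1 !val_v2 /edge_ends opp_edge_val.
by case: k => [[|[|[|[|[|[|//]]]]]] ?].
Qed.

Lemma adj_edges_spec (k m : 'I_6) : m != k -> m != opp_edge k ->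
  [\/ m = adj_ik k, m = adj_ih k, m = adj_jk k | m = adj_jh k].
Proof.
move=> h1 h2.
suff : [|| m == adj_ik k, m == adj_ih k, m == adj_jk k | m == adj_jh k].
  by case/or4P => /eqP ->; [apply: Or41 | apply: Or42 | apply: Or43 | apply: Or44].
move: h1 h2; rewrite -!(inj_eq val_inj) /= opp_edge_val !val_edge_of !val_v1 !val_v2.
rewrite /edge_ends opp_edge_val.
by case: k m => [[|[|[|[|[|[|//]]]]]] ?] [[|[|[|[|[|[|//]]]]]] ?].
Qed.

Lemma opp_edge_adj (k m : 'I_6) :
  m \in [:: adj_ik k; adj_ih k; adj_jk k; adj_jh k] ->
  opp_edge k != m /\ opp_edge k != opp_edge m.
Proof.
move=> h; apply/andP; move: h; rewrite !inE -!(inj_eq val_inj) /= !opp_edge_val !val_edge_of.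
rewrite !val_v1 !val_v2 /edge_ends opp_edge_val.
by case: k m => [[|[|[|[|[|[|//]]]]]] ?] [[|[|[|[|[|[|//]]]]]] ?].
Qed.

Lemma dihedralE (n : nat) (E : finType) (PE : tedge n -> E) (l : E -> R) (s : 'I_n) (k : 'I_6) :
  let X m := cosh (l (PE (s, m))) in
  dihedral PE l (s, k) =
  acos (Rmax (-1) (Rmin (phi_fun (X k) (X (adj_ik k)) (X (adj_ih k)) (X (adj_jk k))
                                 (X (adj_jh k)) (X (opp_edge k))) 1)).
Proof. by rewrite /dihedral /= !edge_of_ends. Qed.

Lemma edge_of_inj (a b c d : 'I_4) : a != b -> c != d -> edge_of a b = edge_of c d ->
  a = c /\ b = d \/ a = d /\ b = c.
Proof.
move=> ab cd h.
case: (ends_edge_of ab) (ends_edge_of cd); rewrite h => -[-> ->] [[-> ->]|[-> ->]]; auto.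
Qed.

(** [p] is the common vertex and [q] the vertex on neither edge, so the face opposite [q] is the one
    to glue across. *)
Lemma adj_edges_share_vertex (g m : 'I_6) : m != g -> m != opp_edge g ->
  exists p p' r q : 'I_4, [/\ uniq [:: p; p'; r; q], g = edge_of p p' & m = edge_of p r].
Proof.
move=> h1 h2; have U := tet_vertices_uniq g; have G := edge_of_ends g.
set a := v1 g in U G *; set b := v2 g in U G *.
set c := v1 (opp_edge g) in U *; set d := v2 (opp_edge g) in U *.
have V : forall i j k l : 'I_4, uniq [:: a; b; c; d] ->
  perm_eq [:: i; j; k; l] [:: a; b; c; d] -> uniq [:: i; j; k; l].
  by move=> i j k l u e; rewrite (perm_uniq e).
case: (adj_edges_spec h1 h2) => ->.
- by exists a, b, c, d; split.
- exists a, b, d, c; split=> //; apply: V => //.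
  by apply/permP => P /=; do 2!congr addn; rewrite addnCA.
- exists b, a, c, d; split=> //; last by rewrite edge_ofC.
  by apply: V => //; apply/permP => P /=; rewrite addnCA.
- exists b, a, d, c; split=> //; last by rewrite edge_ofC.
  by apply: V => //; apply/permP => P /=; rewrite addnCA; do 2!congr addn; rewrite addnCA.
Qed.

Lemma opp_edge_disjoint (p p' r : 'I_4) : p != p' -> p != r -> edge_of p r != opp_edge (edge_of p p').
Proof.
move=> h1 h2; apply/eqP => h.
have U := tet_vertices_uniq (edge_of p p'); rewrite -h in U.
case: (ends_edge_of h1) (ends_edge_of h2) U => -[-> ->] [[-> ->]|[-> ->]];
  by rewrite /= !inE eqxx ?orbT ?andbF.
Qed.

Lemma fourth_vertex (p p' r q z : 'I_4) :
  uniq [:: p; p'; r; q] -> z != p -> z != p' -> z != q -> z = r.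
Proof.
move=> U h1 h2 h3.
have C : #|[:: p; p'; r; q]| = #|'I_4| by rewrite card_ord (card_uniqP U).
have /(subset_cardP C) /(_ z) : [:: p; p'; r; q] \subset 'I_4 by apply/subsetP.
by rewrite !inE (negbTE h1) (negbTE h2) (negbTE h3) orbF => /eqP.
Qed.

Lemma glue_rel_edge_of (n : nat) (sg : 'I_n * 'I_4 -> 'I_n * 'I_4)
    (ph : 'I_n * 'I_4 -> 'I_4 -> 'I_4) (s : 'I_n) (a b q : 'I_4) :
  a != b -> q != a -> q != b ->
  glue_rel sg ph (s, edge_of a b)
    ((sg (s, q)).1, edge_of (ph (s, q) a) (ph (s, q) b)).
Proof.
move=> ab qa qb; apply/existsP; exists q; rewrite /=.
case: (ends_edge_of ab) => -[-> ->]; rewrite qa qb eqxx /= ?eqxx //.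
by rewrite edge_ofC.
Qed.

(* The other tetrahedron at the face spanned by two adjacent edges contains both of them.
   If gluing this face returned [g] to its place, the class of [g] would be a singleton. *)
Lemma adjacent_edges_twin (n : nat) (sg : 'I_n * 'I_4 -> 'I_n * 'I_4)
    (ph : 'I_n * 'I_4 -> 'I_4 -> 'I_4) (E : finType) (PE : tedge n -> E)
    (s : 'I_n) (g m : 'I_6) :
  closed_pseudo3 sg ph -> edge_quotient sg ph PE ->
  (1 < valence PE (PE (s, g)))%N -> m != g -> m != opp_edge g ->
  exists s' g' m', [/\ (s', g') != (s, g), PE (s', g') = PE (s, g),
    PE (s', m') = PE (s, m), m' != g' & m' != opp_edge g'].
Proof.
move=> [sgK sgF phI phF phK] [_ PEc] hv mg mog.
have [p [p' [r [q [U Eg Em]]]]] := adj_edges_share_vertex mg mog.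
have [pp' pr qp qp' qr] : [/\ p != p', p != r, q != p, q != p' & q != r].
  move: U; rewrite /= !inE !negb_or => /and4P [/and3P [a b c] /andP [d e] f _].
  by split=> //; rewrite eq_sym.
pose f := (s, q).
pose s' := (sg f).1; pose g' := edge_of (ph f p) (ph f p'); pose m' := edge_of (ph f p) (ph f r).
have G : glue_rel sg ph (s, g) (s', g') by rewrite Eg; apply: glue_rel_edge_of.
have M : glue_rel sg ph (s, m) (s', m') by rewrite Em; apply: glue_rel_edge_of.
have fpp' : ph f p != ph f p' by rewrite (inj_eq (@phI f)).
have fpr : ph f p != ph f r by rewrite (inj_eq (@phI f)).
exists s', g', m'; split.
- apply/eqP => -[Es Eg'].
  have Esg : sg f = (s, ph f q) by rewrite [LHS]surjective_pairing -Es -phF.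
  have Eends := edge_of_inj fpp' pp' (etrans Eg' Eg).
  have qf : ph f q != p /\ ph f q != p'.
    have d1 : ph f q != ph f p by rewrite (inj_eq (@phI f)).
    have d2 : ph f q != ph f p' by rewrite (inj_eq (@phI f)).
    by case: Eends d1 d2 => -[-> ->].
  (* The image of [q] is off [g], and it is not [q] because [sg] has no fixed point. So the two
     faces of [s] containing [g] are glued to each other. *)
  have rE : ph f q = r.
    apply: (fourth_vertex U (proj1 qf) (proj2 qf)).
    by apply/eqP => e; apply: (sgF f); rewrite Esg e.
  have fr : sg (s, r) = f by rewrite -rE -Esg sgK.
  have phr : edge_of (ph (s, r) p) (ph (s, r) p') = edge_of p p'.
    have K := phK f; rewrite Esg rE in K.
    case: Eends => -[e1 e2]; rewrite -{1}e1 -{1}e2 !K //.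
    by rewrite edge_ofC.
  (* Only the faces opposite [q] and [r] contain [g], and both gluings return [g] to itself. *)
  have nb : forall y, glue_rel sg ph (s, g) y -> y = (s, g).
    move=> [t k] /existsP [z]; rewrite Eg /= => /and4P [z1 z2 /eqP Et /eqP ->].
    have [zp zp' Ek] : [/\ z != p, z != p' &
       edge_of (ph (s, z) (v1 (edge_of p p'))) (ph (s, z) (v2 (edge_of p p'))) =
       edge_of (ph (s, z) p) (ph (s, z) p')].
      move: z1 z2; case: (ends_edge_of pp') => -[-> ->] z1 z2; split=> //; exact: edge_ofC.
    rewrite Ek -Et; case: (z =P q) => [-> | /eqP zq].
      by rewrite -/f -/s' -/g' Es Eg' Eg.
    by rewrite (fourth_vertex U zp zp' zq) fr phr.
  have cl : forall y, connect (glue_rel sg ph) (s, g) y -> y = (s, g).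
    move=> y /connectP [w]; elim: w => [|a w IH] /=; first by move=> _ ->.
    by move=> /andP [/nb -> hw]; apply: IH.
  have /card_gt1P [a [b [/eqP ha /eqP hb /eqP]]] := hv; apply.
  by rewrite (cl a (proj1 (PEc _ _) (esym ha))) (cl b (proj1 (PEc _ _) (esym hb))).
- by apply/esym/PEc/connect1.
- by apply/esym/PEc/connect1.
- apply/eqP => h; case: (edge_of_inj fpr fpp' h) => -[_ /phI e].
    by move: U; rewrite e /= !inE eqxx ?orbT ?andbF.
  by move: U; rewrite e /= !inE eqxx ?orbT ?andbF.
- exact: (opp_edge_disjoint fpp' fpr).
Qed.

(** * Barriers along the flow *)

(** Since [l] stays positive, its derivative K l has the sign of the curvature, and [cosh] is
    increasing; so [min_barrier] applies to the lengths. One edge starting below [y] is enough to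
    start the minimum there. *)
Lemma flow_min_barrier (n : nat) (E : finType) (PE : tedge n -> E) (l0 : E -> R)
    (l : R -> E -> R) (t0 : R) (a b : E) (y : R) :
  1 <= y -> ext_ricci_solution PE l0 l -> cosh (l0 a) < y \/ cosh (l0 b) < y ->
  (forall t, 0 < t <= t0 -> y < cosh (l t a) -> y < cosh (l t b) ->
     Kt PE (l t) a < 0 /\ Kt PE (l t) b < 0) ->
  forall t, 0 <= t <= t0 -> Rmin (cosh (l t a)) (cosh (l t b)) <= y.
Proof.
move=> hy [h0 hpos hd hr] hi hK.
have gtE t e : 0 <= t -> arccosh y < l t e <-> y < cosh (l t e).
  move=> ht; have p := hpos t e ht; have := cosh_le_arccosh p hy.
  by split => h; apply: Rnot_le_lt => h'; [have := proj2 H h' | have := proj1 H h']; lra.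
have leE t : 0 <= t -> Rmin (l t a) (l t b) <= arccosh y ->
    Rmin (cosh (l t a)) (cosh (l t b)) <= y.
  move=> ht; have := gtE t a ht; have := gtE t b ht; rewrite /Rmin.
  case: Rle_dec => _ hb ha; case: Rle_dec => ? h; apply: Rnot_lt_le => h';
    have [] := (proj2 ha, proj2 hb); lra.
have init : exists d, 0 < d /\ forall t, 0 < t < d -> Rmin (l t a) (l t b) <= arccosh y.
  have one c : cosh (l0 c) < y -> exists d, 0 < d /\ forall t, 0 < t < d -> l t c < arccosh y.
    move=> hc; have p := hpos 0 c (Rle_refl _); rewrite h0 in p.
    have g : 0 < arccosh y - l0 c by have := proj2 (cosh_lt_arccosh p hy) hc; lra.
    have [d [d0 Hd]] := right_derivative_continuous (hr c) g.
    exists d; split=> // t ht; have := Hd t ht; rewrite h0 => /Rabs_def2; lra.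
  case: hi => /one [d [d0 Hd]]; exists d; split=> // t ht; left.
    exact: Rle_lt_trans (Rmin_l _ _) (Hd t ht).
  exact: Rle_lt_trans (Rmin_r _ _) (Hd t ht).
have [d [d0 Hd]] := init.
have der c t : 0 < t -> is_derive (fun s => l s c) t (Kt PE (l t) c * l t c) by apply: hd.
have neg t c : 0 < t -> Kt PE (l t) c < 0 -> Kt PE (l t) c * l t c < 0.
  by move=> ht hK'; have := hpos t c (Rlt_le _ _ ht); nra.
have B := min_barrier (der a) (der b) d0 Hd (T := t0).
move=> t [[ht | <-] ht0]; last first.
  rewrite !h0; case: hi => h; apply: Rlt_le.
    exact: Rle_lt_trans (Rmin_l _ _) h.
  exact: Rle_lt_trans (Rmin_r _ _) h.
apply: leE; first lra.
apply: B; last by lra.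
move=> s hs /gtE ga /gtE gb.
by have [] := hK s hs (ga ltac:(lra)) (gb ltac:(lra)); split; apply: neg; lra.
Qed.

Lemma flow_upper_barrier (n : nat) (E : finType) (PE : tedge n -> E) (l0 : E -> R)
    (l : R -> E -> R) (t0 : R) (e : E) (y : R) :
  1 <= y -> ext_ricci_solution PE l0 l -> cosh (l0 e) < y ->
  (forall t, 0 < t <= t0 -> y < cosh (l t e) -> Kt PE (l t) e < 0) ->
  forall t, 0 <= t <= t0 -> cosh (l t e) <= y.
Proof.
move=> hy sol hi hK t ht.
rewrite -(Rmin_left (cosh (l t e)) (cosh (l t e))); last by right.
apply: (flow_min_barrier hy sol (or_introl hi)) ht => s hs h _.
by split; apply: hK.
Qed.

(** This is [min_barrier] for the negated length, taken as both functions. *)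
Lemma flow_lower_barrier (n : nat) (E : finType) (PE : tedge n -> E) (l0 : E -> R)
    (l : R -> E -> R) (t0 : R) (e : E) (y : R) :
  1 <= y -> ext_ricci_solution PE l0 l -> y < cosh (l0 e) ->
  (forall t, 0 < t <= t0 -> cosh (l t e) < y -> 0 < Kt PE (l t) e) ->
  forall t, 0 <= t <= t0 -> y <= cosh (l t e).
Proof.
move=> hy [h0 hpos hd hr] hi hK t [[ht | <-] ht0]; last by rewrite (h0 e); lra.
have p := hpos t e (Rlt_le _ _ ht).
apply: Rnot_lt_le => /(cosh_lt_arccosh p hy) hlt.
have g : 0 < l0 e - arccosh y.
  have p0 := hpos 0 e (Rle_refl _); rewrite h0 in p0.
  have : ~ l0 e <= arccosh y by move/(cosh_le_arccosh p0 hy); lra.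
  lra.
have [d [d0 Hd]] := right_derivative_continuous (hr e) g.
have der s : 0 < s -> is_derive (fun s => - l s e) s (- (Kt PE (l s) e * l s e)).
  by move=> hs; apply: is_derive_opp; apply: hd.
have Hd' s : 0 < s < d -> Rmin (- l s e) (- l s e) <= - arccosh y.
  move=> hs; apply: Rle_trans (Rmin_l _ _) _.
  by have := Hd s hs; rewrite h0 => /Rabs_def2; lra.
have := min_barrier der der d0 Hd' (T := t0) _ (conj ht ht0).
rewrite Rmin_left; last by right.
move=> H; have : - l t e <= - arccosh y; last by lra.
apply: H => s hs hl _.
have ps := hpos s e (Rlt_le _ _ (proj1 hs)).
have := hK s hs (proj1 (cosh_lt_arccosh ps hy) ltac:(lra)); nra.
Qed.

(** * Bounds for [eta], [mu_const] and [b_const] *)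

Lemma eta_ge (xi y d : R) :
  0 <= xi -> -1 <= y <= 1 -> 0 <= d ->
  y * (d ^ 2 + 10 * d + 4) <= 2 * (2 + d) * (1 - d) -> d <= eta xi y.
Proof.
move=> hxi hy hd h; rewrite /eta; apply/Rle_div_r; first lra.
(* [eta] is the larger root z of (2 + y) z^2 + 2 B z = 4 (1 - y) w with B = 2 + 5 y - w. The
   hypothesis puts [d] below this root for w = 1; raising w adds the nonnegative term [e]. *)
set w := (1 + xi) ^ 2; have hw : 1 <= w by rewrite /w; nra.
have e : 0 <= (w - 1) * (4 * (1 - y) + 2 * d) by apply: Rmult_le_pos; lra.
set B := 2 + 5 * y - w.
suff : d * (2 + y) + B <= sqrt (B ^ 2 + 4 * (2 + y) * (1 - y) * w) by rewrite /B; lra.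
apply: Rle_trans (Rle_abs _) _; rewrite -sqrt_Rsqr_abs; apply: sqrt_le_1_alt.
have : 0 <= (2 + y) * (4 * (1 - y) * w - d ^ 2 * (2 + y) - 2 * d * B).
  by apply: Rmult_le_pos; [lra | rewrite /B; lra].
by rewrite /Rsqr; lra.
Qed.

Lemma xi_inf_ge0 : 0 <= xi_inf.
Proof.
have pos k : 0 <= xi_seq k.
  elim: k => [|k IH] /=; first lra.
  have [c1 c2] := COS_bound (2 * PI / 9).
  by apply: eta_ge => //; lra.
rewrite /xi_inf.
have : Rbar_le (Lim_seq (fun _ => 0)) (Lim_seq xi_seq) by apply: Lim_seq_le_loc; exists 0%N.
(* For the value [p_infty], [real] returns 0. *)
by rewrite Lim_seq_const; case: (Lim_seq xi_seq) => //= _; lra.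
Qed.

Lemma two_PI_div_le (m N : nat) : (0 < N)%N -> (N <= m)%N -> 2 * PI / INR m <= 2 * PI / INR N.
Proof.
move=> /leP N0 /leP Nm; have := PI_bounds => P.
apply: Rmult_le_compat_l; first lra.
by apply: Rinv_le_contravar; [apply: lt_0_INR | apply: le_INR].
Qed.

(** [psi] approximates 2 pi / N from below, as 6.283 < 2 pi; so cos (2 pi / m) <= cos psi, which the
    quartic bounds from above as [eta_ge] requires. *)
Lemma mu_const_ge (m N : nat) (psi d : R) :
  (9 <= m)%N -> (m <= N)%N -> 0 <= psi <= 2 -> psi * INR N <= 6.283 -> 0 <= d ->
  (1 - psi ^ 2 / 2 + psi ^ 4 / 24) * (d ^ 2 + 10 * d + 4) <= 2 * (2 + d) * (1 - d) ->
  d <= mu_const m.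
Proof.
move=> hm hN hpsi hpN hd h; have P := PI_bounds.
have m0 : (0 < m)%N by apply: leq_trans hm.
have le1 := two_PI_div_le m0 hN.
have le9 : 2 * PI / INR m <= 2 * PI / INR 9 by apply: two_PI_div_le.
have [c1 c2] := COS_bound (2 * PI / INR m).
apply: eta_ge => //; first exact: xi_inf_ge0.
apply: Rle_trans h; apply: Rmult_le_compat_r; first nra.
apply: Rle_trans (cos_le_taylor4 (a := psi) _); last lra.
have N0 : 0 < INR N by apply/lt_0_INR/leP/(leq_trans m0 hN).
have ge : psi <= 2 * PI / INR N by apply/Rle_div_r; lra.
move: le9; rewrite (INR_IZR_INZ 9) /= => le9.
by apply: cos_decr_1; lra.
Qed.

Lemma b_const_ge1 (m : nat) : (10 <= m)%N -> 1 <= b_const m.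
Proof.
move=> hm; rewrite /b_const; case: eqP => [e | _]; first lra.
have P := PI_bounds; have le10 := two_PI_div_le (isT : (0 < 10)%N) hm.
rewrite (INR_IZR_INZ 10) /= in le10.
have m0 : 0 < INR m by apply/lt_0_INR/leP/(leq_trans _ hm).
have a0 : 0 < 2 * PI / INR m by apply: Rdiv_lt_0_compat; lra.
have c0 : 0 < cos (2 * PI / INR m) by apply: cos_gt_0; lra.
have [_ c2] := COS_bound (2 * PI / INR m).
suff : 8 <= 16 / (1 + cos (2 * PI / INR m)) by lra.
have d0 : 1 + cos (2 * PI / INR m) > 0 by lra.
by apply/(Rle_div_r 8 16 _ d0); lra.
Qed.

(** [th] approximates 2 pi / N from above. With adjacent edges 2 and opposite edge 1 the cosine of
    the angle is (9 - x) / (x + 7); for [m] at least 10, [b_const m] is the x at which this angle is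
    2 pi / m. *)
Lemma b_const_le (m N : nat) (th F : R) :
  (10 <= N)%N -> (N <= m)%N -> 0 <= th <= 1 -> 6.2832 <= th * INR N -> 1 <= F ->
  9 - F <= cos th * (F + 7) -> b_const m <= F.
Proof.
move=> hN hm hth h hF hc; rewrite /b_const; case: eqP => [e | _].
  by move: (leq_trans hN hm); rewrite e.
have P := PI_bounds.
have N0 : (0 < N)%N by apply: leq_trans hN.
have le1 := two_PI_div_le N0 hm.
have NR : 0 < INR N by apply/lt_0_INR/leP.
have mR : 0 < INR m by apply/lt_0_INR/leP/(leq_trans N0 hm).
have a0 : 0 < 2 * PI / INR m by apply: Rdiv_lt_0_compat; lra.
have le2 : 2 * PI / INR N <= th by apply/Rle_div_l; lra.
have c : cos th <= cos (2 * PI / INR m) by apply: cos_decr_1; lra.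
have c0 : 0 < cos th by apply: cos_gt_0; lra.
suff : 16 / (1 + cos (2 * PI / INR m)) <= F + 7 by lra.
have d0 : 1 + cos (2 * PI / INR m) > 0 by lra.
apply/(Rle_div_l 16 _ _ d0); nra.
Qed.

(** * Angle bounds from edge lengths *)

Lemma dihedral_ge (n : nat) (E : finType) (PE : tedge n -> E) (l : E -> R)
    (s : 'I_n) (k : 'I_6) (th kap : R) :
  let X m := cosh (l (PE (s, m))) in
  0 <= th <= 2 -> kap <= cos_taylor6 th ->
  phi_fun (X k) (X (adj_ik k)) (X (adj_ih k)) (X (adj_jk k)) (X (adj_jh k)) (X (opp_edge k))
    <= kap ->
  th <= dihedral PE l (s, k).
Proof.
move=> X hth hk h; rewrite dihedralE; have P := PI_bounds.
apply: le_acos_clamp; first lra.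
by apply: Rle_trans h (Rle_trans _ _ _ hk _); apply: cos_taylor6_le; lra.
Qed.

Lemma dihedral_ge_opp (n : nat) (E : finType) (PE : tedge n -> E) (l : E -> R)
    (s : 'I_n) (k : 'I_6) (th b c : R) :
  (forall e, 1 <= cosh (l e) <= 2) -> 0 <= th <= 1 ->
  1 <= b <= cosh (l (PE (s, k))) -> 1 <= c <= cosh (l (PE (s, opp_edge k))) ->
  8 - (b - 1) * c <= cos_taylor6 th * (b + 7) ->
  th <= dihedral PE l (s, k).
Proof.
move=> rl hth hb hc h.
have t0 : 0 <= cos_taylor6 th.
  rewrite /cos_taylor6; have : th ^ 2 <= 1 by nra.
  have : th ^ 6 <= 1 by rewrite -(pow1 6); apply: pow_incr.
  have : 0 <= th ^ 4 by apply: pow_le; lra.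
  lra.
apply: dihedral_ge (Rle_refl _) _; first lra.
have r e := rl e.
apply: (@phi_fun_le_all2 b _ _ _ _ _ _ c) => //; try apply: rl.
by apply: (proj2 (rl _)).
by apply: (proj2 (rl _)).
Qed.

Lemma dihedral_ge_adj (n : nat) (E : finType) (PE : tedge n -> E) (l : E -> R)
    (s : 'I_n) (k m : 'I_6) (th kap F c : R) :
  (forall e, 1 <= cosh (l e) <= 2) -> 0 <= th <= 2 ->
  m != k -> m != opp_edge k -> cosh (l (PE (s, m))) <= F <= 2 ->
  1 <= c <= cosh (l (PE (s, opp_edge k))) -> 0 <= kap <= cos_taylor6 th ->
  (let x := cosh (l (PE (s, k))) in
   phi_num x F 2 2 2 c ^ 2 <= kap ^ 2 * (face_det x F 2 * face_det x 2 2)) ->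
  th <= dihedral PE l (s, k).
Proof.
move=> rl hth mk mo hF hc hk h.
apply: dihedral_ge (proj2 hk) _; first lra.
apply: (@phi_fun_le_adj F c) => //; try apply: rl; try lra.
- exact: (proj2 (rl _)).
- by case: (adj_edges_spec mk mo) hF => -> [hF _]; [apply: Or41 | apply: Or42 | apply: Or43 | apply: Or44].
Qed.

Lemma dihedral_ge_pairs (n : nat) (E : finType) (PE : tedge n -> E) (l : E -> R)
    (s : 'I_n) (k : 'I_6) (th kap B c : R) :
  (forall e, 1 <= cosh (l e) <= 2) -> 0 <= th <= 2 -> B <= 2 ->
  (forall m, opp_edge k != m -> opp_edge k != opp_edge m ->
     Rmin (cosh (l (PE (s, m)))) (cosh (l (PE (s, opp_edge m)))) <= B) ->
  1 <= c <= cosh (l (PE (s, opp_edge k))) -> 0 <= kap <= cos_taylor6 th ->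
  (let x := cosh (l (PE (s, k))) in
   phi_num x B B 2 2 c ^ 2 <= kap ^ 2 * (face_det x B 2 * face_det x B 2)) ->
  (let x := cosh (l (PE (s, k))) in
   phi_num x B 2 B 2 c ^ 2 <= kap ^ 2 * (face_det x B B * face_det x 2 2)) ->
  th <= dihedral PE l (s, k).
Proof.
move=> rl hth hB hm hc hk h1 h2.
apply: dihedral_ge (proj2 hk) _; first lra.
apply: (@phi_fun_le_pairs B c) => //; try apply: rl; try lra.
- exact: (proj2 (rl _)).
- rewrite -opp_adj_ik; have [|a b] := @opp_edge_adj k (adj_ik k); last exact: hm.
  by rewrite !inE eqxx.
- rewrite -opp_adj_ih; have [|a b] := @opp_edge_adj k (adj_ih k); last exact: hm.
  by rewrite !inE eqxx orbT.
Qed.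

Lemma dihedral_le (n : nat) (E : finType) (PE : tedge n -> E) (l : E -> R)
    (s : 'I_n) (k : 'I_6) (psi d : R) :
  (forall e, 1 <= cosh (l e) <= 2) -> 0 <= psi <= 2 -> 0 <= d <= 1 ->
  cosh (l (PE (s, k))) <= 1 + d ->
  (1 - psi ^ 2 / 2 + psi ^ 4 / 24) * (2 + d) <= 2 * (1 - d) ->
  dihedral PE l (s, k) <= psi.
Proof.
move=> rl hpsi hd hx h; rewrite dihedralE; have P := PI_bounds.
apply: acos_clamp_le; first lra.
apply: Rle_trans (cos_le_taylor4 (a := psi) _) _; first lra.
apply: (Rle_trans _ (2 * (1 - d) / (2 + d))).
  have d2 : 2 + d > 0 by lra.
  by apply/(Rle_div_r _ _ _ d2).
by apply: phi_fun_ge; try apply: rl; try lra; split=> //; apply: (proj1 (rl _)).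
Qed.

(** * Barriers determined by valence and by adjacency *)

Lemma valence_lower_bound (n : nat) (E : finType) (PE : tedge n -> E) (l0 : E -> R)
    (l : R -> E -> R) (t0 : R) (e : E) (N : nat) (psi d : R) :
  (forall t, 0 <= t <= t0 -> forall e, 1 <= cosh (l t e) <= 2) ->
  ext_ricci_solution PE l0 l -> arccosh (1 + mu_const (valence PE e)) < l0 e ->
  (9 <= valence PE e <= N)%N ->
  0 <= psi <= 2 -> psi * INR N <= 6.283 -> 0 <= d <= 1 ->
  (1 - psi ^ 2 / 2 + psi ^ 4 / 24) * (d ^ 2 + 10 * d + 4) <= 2 * (2 + d) * (1 - d) ->
  forall t, 0 <= t <= t0 -> 1 + d <= cosh (l t e).
Proof.
move=> rl sol hi /andP [h9 hN] hpsi hpN hd h.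
have P := PI_bounds.
have mu := mu_const_ge h9 hN hpsi hpN (proj1 hd) h.
apply: (flow_lower_barrier _ sol); first lra.
  have p : 0 < l0 e by case: sol => s0 sp _ _; rewrite -s0; apply: sp; lra.
  apply: (Rle_lt_trans _ (1 + mu_const (valence PE e))); first lra.
  have m1 : 1 <= 1 + mu_const (valence PE e) by lra.
  by apply: Rnot_le_lt => /(cosh_le_arccosh p m1); lra.
(* Below the barrier each of the at most [N] angles is at most [psi], so their sum stays under 2
   pi. *)
move=> t ht hx; apply: (Kt_pos_valence_le hN (proj1 hpsi)); last lra.
move=> [s k] hs; apply: (@dihedral_le _ _ _ _ _ _ _ d) => //; first by apply: rl; lra.
  by rewrite hs; lra.
(* [d ^ 2 + 10 * d + 4] exceeds [(2 + d) ^ 2] by [6 * d], so the condition for the initial value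
   implies the one for the angles; if the quartic is negative, the nonnegative right side
   suffices. *)
suff : (1 - psi ^ 2 / 2 + psi ^ 4 / 24) * (2 + d) * (2 + d) <= 2 * (1 - d) * (2 + d).
  by move=> a; apply: (Rmult_le_reg_r (2 + d)) => //; lra.
have : -1 <= 1 - psi ^ 2 / 2 + psi ^ 4 / 24 by have := pow2_ge_0 (psi ^ 2 - 6); nra.
nra.
Qed.

(** One inequality serves twice: it puts the initial value below [F], and it makes every angle at
    least [th] once x_e exceeds [F]. *)
Lemma valence_upper_bound (n : nat) (E : finType) (PE : tedge n -> E) (l0 : E -> R)
    (l : R -> E -> R) (t0 : R) (e : E) (N : nat) (th F : R) :
  (forall t, 0 <= t <= t0 -> forall e, 1 <= cosh (l t e) <= 2) ->
  ext_ricci_solution PE l0 l -> l0 e < arccosh (b_const (valence PE e)) ->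
  (10 <= N <= valence PE e)%N -> 0 <= th <= 1 -> 6.2832 <= th * INR N -> 1 <= F ->
  9 - F <= cos_taylor6 th * (F + 7) ->
  forall t, 0 <= t <= t0 -> cosh (l t e) <= F.
Proof.
move=> rl sol hi /andP [h10 hN] hth hthN hF h; have P := PI_bounds.
have hc : 9 - F <= cos th * (F + 7).
  apply: Rle_trans h _; apply: Rmult_le_compat_r; first lra.
  by apply: cos_taylor6_le; lra.
apply: (flow_upper_barrier _ sol) => //.
  have p : 0 < l0 e by case: sol => s0 sp _ _; rewrite -s0; apply: sp; lra.
  have b1 := b_const_ge1 (leq_trans h10 hN).
  have := proj1 (cosh_lt_arccosh p b1) hi.
  have := b_const_le h10 hN hth hthN hF hc; lra.
move=> t ht hx; apply: (Kt_neg_valence_ge hN (proj1 hth)); last lra.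
move=> [s k] hs; apply: (@dihedral_ge_opp _ _ _ _ _ _ _ F 1) => //.
- by apply: rl; lra.
- by rewrite hs; lra.
- by split; [lra | apply: (proj1 (rl t _ _)); lra].
- by lra.
Qed.

(** When both edges of the pair exceed [B], the edge opposite [g] in [s] does so too, which gives
    [th1]; in the neighbouring tetrahedron the opposite edge is only known to be at least 1, which
    gives [th2]. The argument is symmetric, [m] being adjacent to both edges. *)
Lemma adjacent_pair_bound (n : nat) (sg : 'I_n * 'I_4 -> 'I_n * 'I_4)
    (ph : 'I_n * 'I_4 -> 'I_4 -> 'I_4) (E : finType) (PE : tedge n -> E)
    (l0 : E -> R) (l : R -> E -> R) (t0 : R) (s : 'I_n) (g m : 'I_6) (F B th th1 th2 k1 k2 : R) :
  closed_pseudo3 sg ph -> edge_quotient sg ph PE -> (forall e, (9 <= valence PE e)%N) ->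
  (forall t, 0 <= t <= t0 -> forall e, 1 <= cosh (l t e) <= 2) ->
  ext_ricci_solution PE l0 l -> cosh (l0 (PE (s, g))) < B -> 1 <= B ->
  (forall t, 0 <= t <= t0 -> cosh (l t (PE (s, m))) <= F) -> F <= 2 ->
  m != g -> m != opp_edge g ->
  0 <= th <= 1 -> 0 <= th1 <= 2 -> 0 <= th2 <= 2 -> 6.2832 <= th1 + th2 + 7 * th ->
  9 - B <= cos_taylor6 th * (B + 7) ->
  0 <= k1 <= cos_taylor6 th1 -> 0 <= k2 <= cos_taylor6 th2 ->
  (forall x, B <= x <= 2 ->
     phi_num x F 2 2 2 B ^ 2 <= k1 ^ 2 * (face_det x F 2 * face_det x 2 2)) ->
  (forall x, B <= x <= 2 ->
     phi_num x F 2 2 2 1 ^ 2 <= k2 ^ 2 * (face_det x F 2 * face_det x 2 2)) ->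
  forall t, 0 <= t <= t0 ->
    Rmin (cosh (l t (PE (s, g)))) (cosh (l t (PE (s, opp_edge g)))) <= B.
Proof.
move=> cp eq h9 rl sol hi hB hF hF2 mg mo hth hth1 hth2 hs hc hk1 hk2 p1 p2.
have P := PI_bounds.
have neg (g' : 'I_6) t : 0 <= t <= t0 -> m != g' -> m != opp_edge g' -> B < cosh (l t (PE (s, g'))) ->
    B < cosh (l t (PE (s, opp_edge g'))) -> Kt PE (l t) (PE (s, g')) < 0.
  move=> ht mg' mo' x1 x2; have r := rl t ht.
  have v2 : (1 < valence PE (PE (s, g')))%N by apply: leq_trans (h9 _).
  have [s2 [g2 [m2 [ne E1 E2 n1 n2]]]] := adjacent_edges_twin cp eq v2 mg' mo'.
  have one c : 1 <= 1 <= cosh (l t c) by split; [lra | apply: (proj1 (r _))].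
  apply: (@Kt_neg_two_special _ _ _ _ _ (s, g') (s2, g2) th th1 th2) => //.
  - by rewrite eq_sym.
  - lra.
  - move=> [s3 k3] h3; apply: (@dihedral_ge_opp _ _ _ _ _ _ _ B 1) => //; last lra.
    by rewrite h3; lra.
  - apply: (@dihedral_ge_adj _ _ _ _ _ _ m _ k1 F B) => //; first by split=> //; apply: hF.
      by lra.
    by rewrite /=; apply: p1; split; [lra | apply: (proj2 (r _))].
  - apply: (@dihedral_ge_adj _ _ _ _ _ _ m2 _ k2 F 1) => //.
      by rewrite E2; split=> //; apply: hF.
    by rewrite /= E1; apply: p2; split; [lra | apply: (proj2 (r _))].
  - lra.
apply: (flow_min_barrier hB sol (or_introl hi)) => t ht a b.
split; apply: neg => //; rewrite ?opp_edgeK //; lra.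
Qed.

(** The edges adjacent to [k] are also those adjacent to its opposite edge, and they form two
    opposite pairs. The bound [F] on the opposite edge over the whole time interval keeps each
    pair's minimum at most [B]. *)
Lemma dihedral_ge_short_opp (n : nat) (sg : 'I_n * 'I_4 -> 'I_n * 'I_4)
    (ph : 'I_n * 'I_4 -> 'I_4 -> 'I_4) (E : finType) (PE : tedge n -> E)
    (l0 : E -> R) (l : R -> E -> R) (t0 : R) (s : 'I_n) (k : 'I_6) (N : nat)
    (F B c thF th th1 th2 k1 k2 th3 k3 : R) :
  closed_pseudo3 sg ph -> edge_quotient sg ph PE -> (forall e, (9 <= valence PE e)%N) ->
  (forall t, 0 <= t <= t0 -> forall e, 1 <= cosh (l t e) <= 2) ->
  ext_ricci_solution PE l0 l ->
  l0 (PE (s, opp_edge k)) < arccosh (b_const (valence PE (PE (s, opp_edge k)))) ->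
  (forall e, cosh (l0 e) < B) ->
  (10 <= N <= valence PE (PE (s, opp_edge k)))%N ->
  0 <= thF <= 1 -> 6.2832 <= thF * INR N -> 1 <= F <= 2 ->
  9 - F <= cos_taylor6 thF * (F + 7) ->
  0 <= th <= 1 -> 0 <= th1 <= 2 -> 0 <= th2 <= 2 -> 6.2832 <= th1 + th2 + 7 * th ->
  1 <= B <= 2 -> 9 - B <= cos_taylor6 th * (B + 7) ->
  0 <= k1 <= cos_taylor6 th1 -> 0 <= k2 <= cos_taylor6 th2 ->
  (forall x, B <= x <= 2 ->
     phi_num x F 2 2 2 B ^ 2 <= k1 ^ 2 * (face_det x F 2 * face_det x 2 2)) ->
  (forall x, B <= x <= 2 ->
     phi_num x F 2 2 2 1 ^ 2 <= k2 ^ 2 * (face_det x F 2 * face_det x 2 2)) ->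
  0 <= th3 <= 2 -> 0 <= k3 <= cos_taylor6 th3 ->
  (forall x, 1.98 <= x <= 2 ->
     phi_num x B B 2 2 c ^ 2 <= k3 ^ 2 * (face_det x B 2 * face_det x B 2)) ->
  (forall x, 1.98 <= x <= 2 ->
     phi_num x B 2 B 2 c ^ 2 <= k3 ^ 2 * (face_det x B B * face_det x 2 2)) ->
  forall t, 0 <= t <= t0 -> 1.98 <= cosh (l t (PE (s, k))) ->
    1 <= c <= cosh (l t (PE (s, opp_edge k))) ->
    th3 <= dihedral PE (l t) (s, k).
Proof.
move=> cp eq h9 rl sol hb hi hN hthF hthN hF hcF hth hth1 hth2 hs hB hc hk1 hk2 p1 p2 hth3 hk3 p3 p4.
move=> t ht hx hopp.
have up : forall t', 0 <= t' <= t0 -> cosh (l t' (PE (s, opp_edge k))) <= F.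
  exact: (valence_upper_bound rl sol hb hN hthF hthN (proj1 hF) hcF).
have r e := rl t ht e.
apply: (@dihedral_ge_pairs _ _ _ _ _ _ _ k3 B c) => //=; first exact: (proj2 hB).
- move=> m m1 m2.
  exact: (adjacent_pair_bound cp eq h9 rl sol (hi _) (proj1 hB) up (proj2 hF) m1 m2 hth hth1 hth2
    hs hc hk1 hk2 p1 p2).
- by apply: p3; split; [| apply: (proj2 (r _))].
- by apply: p4; split; [| apply: (proj2 (r _))].
Qed.

(** Substituting x = b + y leaves a polynomial inequality on a short interval starting at 0, within
    reach of [nra]. *)
Ltac solve_shifted_poly b :=
  let x := fresh "x" in let hx := fresh "hx" in let y := fresh "y" in let hy := fresh "hy" in
  move=> x hx; rewrite /phi_num /face_det;
  have [y [hy ->]] : exists y, 0 <= y <= 2 - b /\ x = b + y by [exists (x - b); lra];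
  nra.

Ltac solve_numeric := by rewrite ?INR_IZR_INZ /cos_taylor6 /=; lra.

(* The constant 0.68165 satisfies 8 * 0.68165 + 0.8301 > 2 pi. For each range of valences of the
   opposite edge, F is slightly above b_N at its lower end N, 1 + d is slightly below the lower
   barrier at its upper end, and B is the approximate root of th1 + th2 + 7 th = 2 pi, where
   k1 and k2 bound the cosines of the angles at g in the two tetrahedra adjacent to f. *)
Lemma dihedral_ge_198 (n : nat) (sg : 'I_n * 'I_4 -> 'I_n * 'I_4)
    (ph : 'I_n * 'I_4 -> 'I_4 -> 'I_4) (E : finType) (PE : tedge n -> E)
    (l0 : E -> R) (l : R -> E -> R) (t0 t : R) (s : 'I_n) (k : 'I_6) :
  closed_pseudo3 sg ph -> edge_quotient sg ph PE -> (forall e, (9 <= valence PE e)%N) ->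
  (forall t, 0 <= t <= t0 -> forall e, 1 <= cosh (l t e) <= 2) ->
  (forall e, arccosh (1 + mu_const (valence PE e)) < l0 e < arccosh (b_const (valence PE e))) ->
  (forall e, cosh (l0 e) < 1.9) ->
  ext_ricci_solution PE l0 l ->
  0 <= t <= t0 -> 1.98 <= cosh (l t (PE (s, k))) ->
  0.68165 <= dihedral PE (l t) (s, k).
Proof.
move=> cp eq h9 rl hi hi19 sol ht hx.
set o := PE (s, opp_edge k).
have lowb := valence_lower_bound rl sol (proj1 (hi o)).
have short := @dihedral_ge_short_opp n sg ph E PE l0 l t0 s k.
(* Up to valence 12 the lower barrier on the opposite edge suffices alone; from 13 on, the bound on
   pairs is used as well. *)
case: (leqP (valence PE o) 12) => [v12 | v13].
  apply: (@dihedral_ge_opp _ _ _ _ _ _ _ 1.98 1.0495); try (by lra); try solve_numeric.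
    exact: rl.
  have : 1 + 0.0495 <= cosh (l t o); last by rewrite /o; lra.
  by apply: (lowb 12%N (6.283 / 12)) => //; rewrite ?h9 //; solve_numeric.
case: (leqP (valence PE o) 17) => [v17 | v18].
  (* [0.48336] is above 2 pi / 13, and [0.77653] is a lower bound for the cosine of 0.68165, the
     angle left to unification. *)
  apply: (short 13%N 1.4861 1.971 1.0236 0.48336 0.67047 0.87871 0.71197 0.63813 0.75707 _ 0.77653
            cp eq h9 rl sol (proj2 (hi o))) => //; try (by lra); try solve_numeric.
  - by move=> e; have := hi19 e; lra.
  - by solve_shifted_poly 1.971.
  - by solve_shifted_poly 1.971.
  - by solve_shifted_poly 1.98.
  - by solve_shifted_poly 1.98.
  have : 1 + 0.0236 <= cosh (l t o); last by rewrite /o; lra.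
  by apply: (lowb 17%N (6.283 / 17)) => //; rewrite ?h9 //; solve_numeric.
case: (leqP (valence PE o) 28) => [v28 | v29].
  apply: (short 18%N 1.2488 1.9562 1.0084 0.34911 0.66571 0.89711 0.72705 0.62386 0.74713 _ 0.77653
            cp eq h9 rl sol (proj2 (hi o))) => //; try (by lra); try solve_numeric.
  - by move=> e; have := hi19 e; lra.
  - by solve_shifted_poly 1.9562.
  - by solve_shifted_poly 1.9562.
  - by solve_shifted_poly 1.98.
  - by solve_shifted_poly 1.98.
  have : 1 + 0.0084 <= cosh (l t o); last by rewrite /o; lra.
  by apply: (lowb 28%N (6.283 / 28)) => //; rewrite ?h9 //; solve_numeric.
(* With no upper limit on the valence, the lower bound on the opposite edge is just 1. *)
apply: (short 29%N 1.0947 1.9465 1 0.21674 0.66257 0.90971 0.73699 0.61396 0.74049 _ 0.77653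
          cp eq h9 rl sol (proj2 (hi o))) => //; try (by lra); try solve_numeric.
- by move=> e; have := hi19 e; lra.
- by solve_shifted_poly 1.9465.
- by solve_shifted_poly 1.9465.
- by solve_shifted_poly 1.98.
- by solve_shifted_poly 1.98.
by split; [lra | apply: (proj1 (rl t ht _))].
Qed.

Unset Implicit Arguments.

Theorem theorem5p4 (n : nat) (sg : 'I_n * 'I_4 -> 'I_n * 'I_4)
  (ph : 'I_n * 'I_4 -> 'I_4 -> 'I_4) (E : finType) (PE : tedge n -> E)
  (l0 : E -> R) (l : R -> E -> R) (t0 : R) :
  closed_pseudo3 sg ph ->
  edge_quotient sg ph PE ->
  (forall e : E, (9 <= valence PE e)%N) ->
  (forall e : E, 0 < l0 e < arccosh (19 / 10)) ->
  (forall e : E, arccosh (1 + mu_const (valence PE e)) < l0 e <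
                 arccosh (b_const (valence PE e))) ->
  ext_ricci_solution PE l0 l ->
  0 < t0 ->
  (forall t (e : E), 0 <= t <= t0 -> l t e <= arccosh 2) ->
  forall (s : 'I_n) (k : 'I_6) (t : R), 0 <= t <= t0 ->
    Rmin (cosh (l t (PE (s, k)))) (cosh (l t (PE (s, opp_edge k)))) <= 198 / 100.
Proof.
move=> cp eq h9 hi19 hi sol t0pos h2 s k.
have rl t : 0 <= t <= t0 -> forall e, 1 <= cosh (l t e) <= 2.
  move=> ht e; have p : 0 < l t e by case: sol => _ sp _ _; apply: sp; lra.
  by split; [left; apply: one_lt_cosh | apply/(cosh_le_arccosh p); [lra | apply: h2]].
have hc e : cosh (l0 e) < 1.9.
  have [p q] := hi19 e; have y1 : 1 <= 19 / 10 by lra.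
  by have := proj1 (cosh_lt_arccosh p y1) q; lra.
have P := PI_bounds.
have neg (k' : 'I_6) t : 0 <= t <= t0 -> 1.98 <= cosh (l t (PE (s, k'))) ->
    1.98 <= cosh (l t (PE (s, opp_edge k'))) -> Kt PE (l t) (PE (s, k')) < 0.
  move=> ht x1 x2.
  apply: (@Kt_neg_one_special _ _ _ _ _ (s, k') 0.68165 0.8301) => //; try (by lra).
    move=> [s3 k3] h3; apply: (dihedral_ge_198 cp eq h9 rl hi hc sol ht).
    by rewrite h3.
  (* The special angle lies in [s], where both the edge and its opposite are at least 1.98. *)
  apply: (@dihedral_ge_opp _ _ _ _ _ _ _ 1.98 1.98); try (by lra); try solve_numeric.
  exact: rl.
apply: (flow_min_barrier _ sol); [lra | by left; have := hc (PE (s, k)); lra |].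
move=> t ht x1 x2; have ht' : 0 <= t <= t0 by lra.
split; apply: neg => //; rewrite ?opp_edgeK; lra.
Qed.
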